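(* Let $G$ and $H$ be graphs and write $i\colon G\to G\sqcup H$ and $j\colon H\to G\sqcup H$ for the inclusion maps into the disjoint union. Then the induced map \[ i_*\oplus j_*\colon \mathrm{MH}_{*,*}(G)\oplus\mathrm{MH}_{*,*}(H)\longrightarrow \mathrm{MH}_{*,*}(G\sqcup H),\qquad (a,b)\mapsto i_*(a)+j_*(b), \] is an isomorphism.
   Context: A graph is a finite undirected graph with no loops or multiple edges. $d(x,y)$ is the length of a shortest edge path from $x$ to $y$ ($\infty$ if in different components). The length of a tuple of vertices is $\ell(x_0,\dots,x_k)=\sum_{i=1}^{k} d(x_{i-1},x_i)$. $\mathrm{MC}_{k,l}(G)$ ($k,l\ge0$) is the free abelian group on tuples $(x_0,\dots,x_k)$ of vertices with consecutive entries distinct and $\ell(x_0,\dots,x_k)=l$. The differential $\partial\colon \mathrm{MC}_{k,l}(G)\to\mathrm{MC}_{k-1,l}(G)$ is $\partial=\sum_{i=1}^{k-1}(-1)^i\partial_i$, where $\partial_i$ omits the $i$-th entry $x_i$ if the resulting tuple still has length $l$, and is $0$ otherwise. $\mathrm{MH}_{k,l}(G)=H_k(\mathrm{MC}_{*,l}(G))$. A map of graphs $f\colon G\to G'$ is a map $V(G)\to V(G')$ such that for each edge $\{x,y\}$ of $G$, either $\{f(x),f(y)\}$ is an edge of $G'$ or $f(x)=f(y)$. It induces a chain map sending $(x_0,\dots,x_k)$ to $(f(x_0),\dots,f(x_k))$ if this has the same length as $(x_0,\dots,x_k)$, and to $0$ otherwise; $f_*$ is the induced map on $\mathrm{MH}_{*,*}$.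 *)

(* Defs.v *)
From HB Require Import structures.
From mathcomp Require Import all_boot all_order all_algebra.
From mathcomp Require Import boolp.

Set Implicit Arguments.
Unset Strict Implicit.
Unset Printing Implicit Defensive.

Import Order.TTheory GRing.Theory Num.Theory.
Local Open Scope ring_scope.
Local Open Scope quotient_scope.

Record graph := Graph {
  vertex :> finType;
  edge : rel vertex;
  edge_sym : symmetric edge;
  edge_irr : irreflexive edge }.

(* Extended naturals are represented by [option nat], [None] being infinity. *)
Definition oadd (a b : option nat) : option nat :=
  if a is Some m then if b is Some n then Some (m + n)%N else None else None.

Definition ole (a b : option nat) : bool :=
  if b is Some n then if a is Some m then (m <= n)%N else false else true.

Section Distance.
Variable G : graph.
Implicit Types x y : G.

(* There is an edge path with n edges from x to y. *)
Definition walk (n : nat) x y : bool :=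
  [exists p : n.-tuple G, path (@edge G) x p && (last x p == y)].

Lemma walkP n x y :
  reflect (exists p, [/\ path (@edge G) x p, last x p = y & size p = n])
          (walk n x y).
Proof.
apply: (iffP existsP) => [[p /andP[xp /eqP yp]]|[p [xp yp /eqP sp]]].
  by exists p; rewrite size_tuple.
by exists (Tuple sp); rewrite /= xp yp eqxx.
Qed.

Lemma connect_walk x y : connect (@edge G) x y -> exists n, walk n x y.
Proof.
by case/connectP=> p xp yp; exists (size p); apply/walkP; exists p.
Qed.

Definition dist x y : option nat :=
  match @idP (connect (@edge G) x y) with
  | ReflectT xy => Some (ex_minn (connect_walk xy))
  | ReflectF _ => None
  end.

Lemma distP x y n :
  ole (dist x y) (Some n) <-> exists2 m, (m <= n)%N & walk m x y.
Proof.
rewrite /dist; case: {-}_ / idP => [xy|nxy] /=.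
  case: ex_minnP => m wm mmin; split=> [mn|[m' m'n wm']]; first by exists m.
  exact: leq_trans (mmin _ wm') m'n.
split=> // -[m _ /walkP[p [xp yp _]]]; case: nxy.
by apply/connectP; exists p.
Qed.

End Distance.

Fixpoint len (G : graph) (s : seq G) : option nat :=
  if s is x :: s' then
    if s' is y :: _ then oadd (dist x y) (len s') else Some 0%N
  else Some 0%N.

Arguments len : simpl never.

Definition valid (G : graph) (k l : nat) (s : seq G) : bool :=
  [&& size s == k.+1, sorted (fun x y => x != y) s & len s == Some l].

Definition gen (G : graph) (k l : nat) : Type :=
  {x : k.+1.-tuple G | valid k l x}.

(* The free abelian group on the finite type [gen G k l]. *)
Definition MC (G : graph) (k l : nat) : Type := {ffun gen G k l -> int}.

(* The basis element given by the tuple [s] if [s] is a generator, and 0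
   otherwise. *)
Definition bas (G : graph) (k l : nat) (s : seq G) : MC G k l :=
  [ffun x : gen G k l => (tval (val x) == s)%:R].

Definition lin (A : finType) (M : zmodType) (F : A -> M)
  (c : {ffun A -> int}) : M := \sum_(a : A) F a *~ c a.

Definition omit (T : Type) (i : nat) (s : seq T) : seq T :=
  take i s ++ drop i.+1 s.

(* A tuple of length l obtained by omitting an interior entry of a generator
   automatically has distinct consecutive entries (see [sorted_omit]), so the
   i-th term is 0 exactly when omitting the entry changes the length.  For
   k = 0 the sum is empty, so this is the zero map from [MC G 0 l], which
   replaces the map to the zero group in degree -1. *)
Definition d (G : graph) (k l : nat) : MC G k l -> MC G k.-1 l :=
  lin (fun x : gen G k l =>
    \sum_(1 <= i < k) bas k.-1 l (omit i (tval (val x))) *~ (-1) ^+ i).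

Section Linear.
Variables (A : finType) (M : zmodType).
Implicit Types F : A -> M.

Lemma lin_is_zmod_morphism F : zmod_morphism (lin F).
Proof.
move=> c c'; rewrite /lin -sumrB; apply: eq_bigr => a _.
by rewrite !ffunE mulrzBr.
Qed.
HB.instance Definition _ F :=
  GRing.isZmodMorphism.Build {ffun A -> int} M (lin F) (lin_is_zmod_morphism F).

End Linear.

HB.instance Definition _ G k l :=
  GRing.isZmodMorphism.Build (MC G k l) (MC G k.-1 l) (@d G k l)
    (lin_is_zmod_morphism _).

Section Basis.
Variable G : graph.

Lemma bas_invalid k l (s : seq G) : ~~ valid k l s -> bas k l s = 0.
Proof.
move=> sN; apply/ffunP=> x; rewrite !ffunE; case: eqP => // xs.
by rewrite -xs (valP x) in sN.
Qed.

Lemma lin_bas k l (M : zmodType) (F : seq G -> M) (s : seq G) :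
  lin (fun x : gen G k l => F (tval (val x))) (bas k l s) =
  if valid k l s then F s else 0.
Proof.
case: ifP => [sv|/negbT sN]; last by rewrite bas_invalid // raddf0.
have /andP[ss _] := sv; pose t : k.+1.-tuple G := Tuple ss.
have tv : valid k l t by [].
rewrite /lin (bigD1 (Sub t tv)) //= big1 ?addr0 => [|x xt].
  by rewrite ffunE /= eqxx.
rewrite ffunE; case: eqP => [xs|]; last by rewrite mulr0z.
by case/eqP: xt; do 2![apply: val_inj].
Qed.

End Basis.

Lemma ole_refl a : ole a a. Proof. by case: a => //= n. Qed.

Lemma ole_trans b a c : ole a b -> ole b c -> ole a c.
Proof. by case: a b c => [a|] [b|] [c|] //=; apply: leq_trans. Qed.

Lemma ole_add a a' b b' : ole a a' -> ole b b' -> ole (oadd a b) (oadd a' b').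
Proof. by case: a a' b b' => [a|] [a'|] [b|] [b'|] //=; apply: leq_add. Qed.

Lemma ole_anti a b : ole a b -> ole b a -> a = b.
Proof.
case: a b => [a|] [b|] //= ab ba; congr Some.
by apply/eqP; rewrite eqn_leq ab.
Qed.

Lemma oaddA : associative oadd.
Proof. by move=> [a|] [b|] [c|] //=; rewrite addnA. Qed.

Section DistanceTheory.
Variable G : graph.
Implicit Types (x y z : G) (s : seq G).

Lemma dist_walk x y n : dist x y = Some n -> walk n x y.
Proof.
rewrite /dist; case: {-}_ / idP => // xy -[<-].
by case: ex_minnP.
Qed.

Lemma dist_refl x : dist x x = Some 0%N.
Proof.
have /distP: exists2 m, (m <= 0)%N & walk m x x.
  by exists 0%N => //; apply/walkP; exists [::].
by case: (dist x x) => //= n; rewrite leqn0 => /eqP->.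
Qed.

Lemma dist_eq0 x y : dist x y = Some 0%N -> x = y.
Proof. by move/dist_walk/walkP=> [p [_ yp /size0nil p0]]; rewrite p0 in yp. Qed.

Lemma dist_triangle x y z : ole (dist x z) (oadd (dist x y) (dist y z)).
Proof.
case xy: (dist x y) => [m|] //=; case yz: (dist y z) => [n|] //.
apply/distP; exists (m + n)%N => //.
have /walkP[p [xp yp <-]] := dist_walk xy.
have /walkP[q [yq zq <-]] := dist_walk yz.
apply/walkP; exists (p ++ q).
by rewrite cat_path last_cat size_cat xp yp.
Qed.

Lemma len_cons x y s : len [:: x, y & s] = oadd (dist x y) (len (y :: s)).
Proof. by []. Qed.

Lemma omitS (T : Type) i (x : T) (s : seq T) : omit i.+1 (x :: s) = x :: omit i s.
Proof. by []. Qed.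

Lemma omit0 (T : Type) (x : T) (s : seq T) : omit 0 (x :: s) = s.
Proof. by rewrite /omit take0 drop1. Qed.

Lemma size_omit (T : Type) i (s : seq T) :
  (i < size s)%N -> size (omit i s) = (size s).-1.
Proof.
move=> i_s; rewrite size_cat size_takel ?size_drop; last exact: ltnW.
by case: (size s) i_s => // n; rewrite ltnS subSS => /subnKC.
Qed.

Lemma map_omit (T U : Type) (f : T -> U) i (s : seq T) : map f (omit i s) = omit i (map f s).
Proof. by rewrite map_cat map_take map_drop. Qed.

Lemma omit_omit (T : Type) i j (s : seq T) :
  (i <= j)%N -> omit i (omit j.+1 s) = omit j (omit i s).
Proof.
elim: s i j => [|x s IHs] [|i] [|j] //=; last first.
  by rewrite ltnS => ij; rewrite !omitS IHs.
all: by move=> _; rewrite omitS /omit /= !drop0.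
Qed.

Lemma len_omit i s : (0 < i)%N -> ole (len (omit i s)) (len s).
Proof.
case: i => // i _; elim: s i => [|x s IHs] i //.
rewrite omitS; case: s IHs => [|y s] IHs //.
case: i => [|i]; last by rewrite omitS; apply: ole_add (ole_refl _) (IHs i).
rewrite omit0; case: s {IHs} => [|z s]; first by rewrite len_cons; case: dist.
by rewrite !len_cons oaddA; apply: ole_add (ole_refl _); apply: dist_triangle.
Qed.

Lemma oadd_some a b n : oadd a b = Some n ->
  exists m p, [/\ a = Some m, b = Some p & (m + p)%N = n].
Proof. by case: a b => [a|] [b|] //= [<-]; exists a, b. Qed.

Lemma oadd_inj a b c n : oadd a b = Some n -> oadd a c = Some n -> b = c.
Proof.
case: a b c => [a|] [b|] [c|] //= [<-] [] /eqP.
by rewrite eqn_add2l => /eqP->.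
Qed.

Lemma sorted_omit i s n : (0 < i)%N ->
    sorted (fun x y => x != y) s ->
    len s = Some n -> len (omit i s) = Some n ->
  sorted (fun x y => x != y) (omit i s).
Proof.
case: i => // i _; elim: s i n => [|x s IHs] i n //.
case: s IHs => [|y s] IHs //; rewrite omitS.
case: i => [|i].
  case: s {IHs} => [|z s] //; rewrite omit0 !len_cons.
  case/and3P=> xy yz zs sn tn; apply/andP; split; last exact: zs.
  apply: contraTneq xy => xz; move: sn tn; rewrite -{}xz {z yz zs}.
  rewrite dist_refl; move: (len (x :: s)) => L.
  case xyE: (dist x y) => [a|] //; case: (dist y x) => [b|] //.
  case: L => [c|] //= [<-] [] /eqP.
  rewrite addnA add0n -{1}[c]add0n eqn_add2r eq_sym addn_eq0 => /andP[/eqP a0 _].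
  by move: xyE; rewrite a0 => /dist_eq0->; rewrite eqxx.
rewrite omitS => /andP[xy ys]; rewrite !len_cons -omitS => sn tn.
have st := oadd_inj sn tn; apply/andP; split; first by [].
case sE: (len (y :: s)) st sn => [m|] => [/esym tE _|]; last by case: (dist x y).
exact: IHs ys sE tE.
Qed.

Lemma len_omit_eq i s (t : seq G) n : (0 < i)%N -> len s = Some n -> len t = Some n ->
  ole (len t) (len (omit i s)) -> len (omit i s) = Some n.
Proof.
move=> i0 sn tn ti; rewrite -sn; apply: ole_anti (len_omit s i0) _.
by rewrite sn -tn.
Qed.

End DistanceTheory.

Lemma alternating_sum (M : zmodType) (a : nat -> nat -> M) n :
    (forall i j, (i <= j)%N -> a i j = - a j.+1 i) ->
  \sum_(1 <= i < n.+2) \sum_(1 <= j < n.+1) a i j = 0.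
Proof.
move=> aN; elim: n => [|n IHn].
  by rewrite big_nat1 big_geq.
rewrite big_nat_recr //= (eq_bigr _ (fun i _ => big_nat_recr _ _ _ _)) //=.
rewrite big_split /= IHn add0r [X in _ + X]big_nat_recr //=.
rewrite [X in X + _]big_nat_recr //= aN // addrACA addNr addr0.
rewrite -big_split big_nat big1 //= => i /andP[_]; rewrite ltnS => i_n.
by rewrite [a i _]aN ?addNr // ltnW.
Qed.

Section Square.
Variables (G : graph) (l : nat).

Lemma d_bas k (s : seq G) : d (bas k l s) =
  if valid k l s then
    \sum_(1 <= i < k) bas k.-1 l (omit i s) *~ (-1) ^+ i
  else 0.
Proof.
exact: (@lin_bas G k l _
  (fun t : seq G => \sum_(1 <= i < k) bas k.-1 l (omit i t) *~ (-1) ^+ i) s).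
Qed.

Lemma valid_omit k i (s : seq G) : (0 < i < k)%N -> valid k l s ->
  valid k.-1 l (omit i s) = (len (omit i s) == Some l).
Proof.
case/andP=> i0 ik /and3P[/eqP sk ss /eqP sl].
apply/idP/idP=> [/and3P[]//|/eqP tl]; apply/and3P; split; last exact/eqP.
  by rewrite size_omit sk ?prednK //; [case: k ik {sk} | apply: ltnW].
exact: sorted_omit ss sl tl.
Qed.

Lemma d_square k (c : MC G k l) : d (d c) = 0.
Proof.
rewrite [X in d X]/d /lin raddf_sum big1 //= => x _.
rewrite raddfMz /= (_ : d _ = 0) ?mul0rz //.
move: (tval _) (valP x) => {x c} s sv; rewrite raddf_sum /=.
transitivity (\sum_(1 <= i < k) \sum_(1 <= j < k.-1)
    bas k.-2 l (omit j (omit i s)) *~ ((-1) ^+ (i + j)) : MC G k.-2 l).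
  apply: eq_big_nat => i /[dup] ik /andP[i0 _].
  rewrite raddfMz /= d_bas; case: ifP => [_|/negbT].
    rewrite mulrz_suml; apply: eq_bigr => j _.
    by rewrite -mulrzA -exprD addnC.
  rewrite mul0rz valid_omit // => tN; rewrite big_nat big1 // => j /andP[j0 _].
  rewrite bas_invalid ?mul0rz //; apply: contra tN => /and3P[_ _ /eqP ul].
  have /and3P[_ _ /eqP sl] := sv; apply/eqP.
  exact: len_omit_eq sl ul (len_omit _ j0).
case: k {sv} => [|[|k]] /=; do ?by rewrite big_geq.
apply: alternating_sum => i j ij; rewrite omit_omit // addSn exprS mulN1r mulrNz.
by rewrite opprK addnC.
Qed.

End Square.

Section Homology.
Variables (G : graph) (k l : nat).

Definition is_cycle : {pred MC G k l} := fun c => d c == 0.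

Lemma is_cycle_zmod_closed : zmod_closed is_cycle.
Proof.
split=> [|c c']; first by rewrite /in_mem /= /is_cycle raddf0.
rewrite /in_mem /= /is_cycle => /eqP c0 /eqP c'0.
by rewrite raddfB /= c0 c'0 subr0.
Qed.
HB.instance Definition _ :=
  GRing.isZmodClosed.Build (MC G k l) is_cycle is_cycle_zmod_closed.

Definition cycle_group : Type := {c : MC G k l | is_cycle c}.
HB.instance Definition _ := SubType.on cycle_group.
HB.instance Definition _ := Choice.on cycle_group.
HB.instance Definition _ := [SubChoice_isSubZmodule of cycle_group by <:].

(* Boundaries in degree k as a subgroup of the cycles; all of them are cycles
   by [d_square]. *)
Definition is_boundary : {pred cycle_group} :=
  fun z => `[< exists b : MC G k.+1 l, d b = val z >].

Lemma is_boundary_zmod_closed : zmod_closed is_boundary.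
Proof.
split=> [|z z' /asboolP[b bz] /asboolP[b' bz']]; apply/asboolP.
  by exists 0; rewrite !raddf0.
by exists (b - b'); rewrite !raddfB /= bz bz'.
Qed.
HB.instance Definition _ :=
  GRing.isZmodClosed.Build cycle_group is_boundary is_boundary_zmod_closed.

Definition MH : zmodType := Quotient.quot is_boundary.

Definition hclass (z : cycle_group) : MH := \pi_(Quotient.quot is_boundary) z.

End Homology.

Record graph_map (G G' : graph) := GraphMap {
  gmap :> G -> G';
  gmap_edge : forall x y, edge x y -> edge (gmap x) (gmap y) \/ gmap x = gmap y }.

(* If the image of a generator has the same length, then its consecutive
   entries are distinct, see [sorted_map_len]; so the image is sent to 0 by
   [bas] exactly when its length changes. *)
Definition MCmap (G G' : graph) (f : graph_map G G') (k l : nat) :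
    MC G k l -> MC G' k l :=
  lin (fun x : gen G k l => bas k l (map f (tval (val x)))).

HB.instance Definition _ G G' (f : graph_map G G') k l :=
  GRing.isZmodMorphism.Build (MC G k l) (MC G' k l) (@MCmap G G' f k l)
    (lin_is_zmod_morphism _).

Section Functoriality.
Variables (G G' : graph) (f : graph_map G G').

Lemma walk_map n x y : walk n x y -> exists2 m, (m <= n)%N & walk m (f x) (f y).
Proof.
case/walkP=> p [xp <- <-] {n y}; elim: p x xp => [|y p IHp] x /=.
  by move=> _; exists 0%N => //; apply/walkP; exists [::].
case/andP=> xy /IHp[m mp /walkP[q [yq zq qm]]].
have [fxy|->] := gmap_edge f xy.
  by exists m.+1 => //; apply/walkP; exists (f y :: q); rewrite /= fxy yq zq qm.
by exists m; [apply: leqW | apply/walkP; exists q].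
Qed.

Lemma dist_map x y : ole (dist (f x) (f y)) (dist x y).
Proof.
case xy: (dist x y) => [n|]; last by [].
by apply/distP/walk_map/dist_walk.
Qed.

Lemma len_map (s : seq G) : ole (len (map f s)) (len s).
Proof.
elim: s => [|x [|y s] IHs] //.
by rewrite !map_cons !len_cons; apply: ole_add (dist_map _ _) IHs.
Qed.

Lemma sorted_of_map (s : seq G) :
  sorted (fun x y => x != y) (map f s) -> sorted (fun x y => x != y) s.
Proof.
rewrite sorted_map; apply: sub_sorted => x y /=.
by apply: contra_neq => ->.
Qed.

Lemma sorted_map_len (s : seq G) n :
    sorted (fun x y => x != y) s -> len s = Some n -> len (map f s) = Some n ->
  sorted (fun x y => x != y) (map f s).
Proof.
elim: s n => [|x [|y s] IHs] n //; rewrite !map_cons !len_cons -map_cons.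
case/andP=> xy ys sn tn.
have := len_map (y :: s); have := dist_map x y.
have [a [b [aE bE ab]]] := oadd_some sn.
have [a' [b' [aE' bE' a'b']]] := oadd_some tn.
rewrite aE bE aE' bE' => /= a'a b'b.
have [a'E b'E] : a' = a /\ b' = b.
  have /eqP := etrans a'b' (esym ab).
  move: a'a b'b; rewrite leq_eqVlt => /predU1P[-> _|a'a b'b].
    by rewrite eqn_add2l => /eqP->.
  have : (a' + b' < a + b)%N by exact: leq_add a'a b'b.
  by rewrite ltn_neqAle => /andP[/negbTE->].
apply/andP; split; last by apply: IHs ys bE _; rewrite bE' b'E.
apply: contra_neq xy => fxy; apply: dist_eq0; rewrite aE -a'E.
by move: aE'; rewrite fxy dist_refl => -[<-].
Qed.

Lemma MCmap_bas k l (s : seq G) :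
  MCmap f (bas k l s) = if valid k l s then bas k l (map f s) else 0.
Proof. exact: (@lin_bas G k l _ (fun t : seq G => bas k l (map f t)) s). Qed.

Lemma MCmap_d k l (c : MC G k l) : d (MCmap f c) = MCmap f (d c).
Proof.
rewrite {1}/MCmap [X in MCmap f X]/d /lin !raddf_sum; apply: eq_bigr => x _.
rewrite !raddfMz /=; congr (_ *~ _).
move: (tval _) (valP x) => {c x} s sv; rewrite d_bas raddf_sum /=.
have /and3P[/eqP ss so /eqP sl] := sv.
transitivity (\sum_(1 <= i < k)
    bas k.-1 l (omit i (map f s)) *~ (-1) ^+ i : MC G' k.-1 l).
  case: ifPn => // fsN; rewrite big_nat big1 // => i /andP[i0 _].
  rewrite bas_invalid ?mul0rz //; apply: contra fsN => /and3P[_ _ /eqP tl].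
  have fsl : len (map f s) = Some l.
    apply: ole_anti; first by rewrite -sl len_map.
    by rewrite -tl len_omit.
  by rewrite /valid size_map ss fsl !eqxx (sorted_map_len so sl fsl).
apply: eq_big_nat => i /[dup] ik /andP[i0 _].
rewrite raddfMz /= MCmap_bas map_omit; case: ifPn => // sN.
rewrite bas_invalid //; apply: contra sN => /and3P[_ _ /eqP tl].
rewrite valid_omit //; apply/eqP/ole_anti.
  by rewrite -sl len_omit.
by rewrite -tl -map_omit len_map.
Qed.

Variables k l : nat.

Lemma MCmap_cycle (z : cycle_group G k l) : is_cycle (MCmap f (val z)).
Proof.
by apply/eqP; rewrite MCmap_d (eqP (valP z)) raddf0.
Qed.

Definition cycle_map (z : cycle_group G k l) : cycle_group G' k l :=
  Sub (MCmap f (val z)) (MCmap_cycle z).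

Lemma cycle_map_is_zmod_morphism : zmod_morphism cycle_map.
Proof. by move=> z z'; apply: val_inj; rewrite /= !raddfB. Qed.
HB.instance Definition _ :=
  GRing.isZmodMorphism.Build (cycle_group G k l) (cycle_group G' k l) cycle_map
    cycle_map_is_zmod_morphism.

(* Independent of the chosen representative, see [MHmap_hclass]. *)
Definition MHmap (a : MH G k l) : MH G' k l := hclass (cycle_map (repr a)).

Lemma hclass_eq (K : graph) (z z' : cycle_group K k l) :
  hclass z = hclass z' <-> exists b : MC K k.+1 l, d b = val (z - z').
Proof.
split=> [/eqP|zz']; first by rewrite -Quotient.idealrBE => /asboolP.
by apply/eqP; rewrite -Quotient.idealrBE; apply/asboolP.
Qed.

Lemma MHmap_hclass (z : cycle_group G k l) :
  MHmap (hclass z) = hclass (cycle_map z).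
Proof.
have /hclass_eq[b bE] : hclass (repr (hclass z)) = hclass z by apply: reprK.
apply/hclass_eq; exists (MCmap f b).
by rewrite MCmap_d bE -raddfB.
Qed.

End Functoriality.

Section DisjointUnion.
Variables G H : graph.

Definition union_edge : rel (G + H)%type := fun u v =>
  match u, v with
  | inl x, inl y => edge x y
  | inr x, inr y => edge x y
  | _, _ => false
  end.

Lemma union_edge_sym : symmetric union_edge.
Proof. by move=> [x|x] [y|y] //=; apply: edge_sym. Qed.

Lemma union_edge_irr : irreflexive union_edge.
Proof. by move=> [x|x] /=; apply: edge_irr. Qed.

Definition disjoint_union : graph := Graph union_edge_sym union_edge_irr.

Lemma inl_edge (x y : G) : edge x y ->
  @edge disjoint_union (inl x) (inl y) \/ inl x = inl y :> disjoint_union.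
Proof. by left. Qed.

Lemma inr_edge (x y : H) : edge x y ->
  @edge disjoint_union (inr x) (inr y) \/ inr x = inr y :> disjoint_union.
Proof. by left. Qed.

Definition incl_l : graph_map G disjoint_union := GraphMap inl_edge.
Definition incl_r : graph_map H disjoint_union := GraphMap inr_edge.

End DisjointUnion.

(* Main.v *)
Require Import Defs.
From HB Require Import structures.
From mathcomp Require Import all_boot all_order all_algebra.
Import GRing.Theory.
Local Open Scope ring_scope.

(** The decomposition already holds for chain complexes.  Vertices in different
    components are at infinite distance, so a tuple of finite length lies
    entirely in [G] or entirely in [H]; an edge path starting in [G] stays in
    [G], so distances, hence lengths and generators, are the same in [G] and in
    the disjoint union.  Thus the generators of the magnitude complex of the
    union are those of [G] together with those of [H], and the complex is the
    direct sum of the two.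

    The argument is carried out for any two injective graph maps [f], [g] that
    lift edges ([edge_lifting]): these are the inclusions of unions of
    components.  Such an [f] has a chain retraction [MCpull f], which takes a
    generator in the image of [f] to its preimage and kills all others
    ([MCpull_d], [MCmapK]).  When the images of [f] and [g] partition the
    vertices, the retraction of each kills the image of the other
    ([MCpull_disjoint]), and the two resulting projectors add up to the identity
    ([MC_split]).  These three identities between chain maps descend to homology
    and say that the pair of retractions is inverse to the sum of the induced
    maps ([MHsum_bij]). *)

Set Implicit Arguments.
Unset Strict Implicit.
Unset Printing Implicit Defensive.

Lemma MC_additive_ext (G : graph) (k l : nat) (M : zmodType)
    (F F' : {additive MC G k l -> M}) :
    (forall s, valid k l s -> F (bas k l s) = F' (bas k l s)) ->
  F =1 F'.
Proof.
move=> FF' c.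
have -> : c = \sum_(x : gen G k l) bas k l (tval (val x)) *~ c x.
  apply/ffunP=> y; rewrite sum_ffunE (bigD1 y) //= big1 ?addr0 => [|x xy].
    by rewrite ffunMzE ffunE eqxx intz.
  rewrite ffunMzE ffunE; case: eqP => [yx|_]; last by rewrite mul0rz.
  by case/eqP: xy; do 2![apply: val_inj].
by rewrite !raddf_sum; apply: eq_bigr => x _; rewrite !raddfMz FF' ?(valP x).
Qed.

(** For injective [f] this says that [f] identifies [G] with a union of connected
    components of [G'], as an induced subgraph. *)
Definition edge_lifting (G G' : graph) (f : graph_map G G') : Prop :=
  forall x v, edge (f x) v -> exists2 y, v = f y & edge x y.

Section ComponentInclusion.
Variables (G G' : graph) (f : graph_map G G').
Hypotheses (f_inj : injective f) (f_lift : edge_lifting f).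

Lemma path_lift x p : path (@edge G') (f x) p ->
  exists2 q, p = map f q & path (@edge G) x q.
Proof.
elim: p x => [|v p IHp] x /=; first by exists [::].
case/andP=> /f_lift[y -> xy] /IHp[q -> yq].
by exists (y :: q); rewrite /= ?xy.
Qed.

Lemma dist_lift x v n : dist (f x) v = Some n -> exists y, v = f y.
Proof.
case/dist_walk/walkP=> p [/path_lift[q -> _] <- _].
by exists (last x q); rewrite last_map.
Qed.

(** A shortest path in [G'] lifts to [G], so [f] cannot shorten distances. *)
Lemma dist_incl x y : dist (f x) (f y) = dist x y.
Proof.
apply: ole_anti; first exact: dist_map.
case fxy: (dist (f x) (f y)) => [n|]; last by case: dist.
apply/distP; exists n => //.
have /walkP[p [/path_lift[q -> xq] qy <-]] := dist_walk fxy.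
apply/walkP; exists q; rewrite size_map; split=> //.
by apply: f_inj; rewrite -qy last_map.
Qed.

Lemma len_incl s : len (map f s) = len s.
Proof.
by elim: s => [|x [|y s] IHs] //; rewrite !map_cons !len_cons dist_incl -IHs.
Qed.

(** A tuple of finite length stays in the component of its first entry. *)
Lemma len_lift x s n : len (f x :: s) = Some n -> exists t, s = map f t.
Proof.
elim: s x n => [|v s IHs] x n; first by exists [::].
rewrite len_cons => /oadd_some[m [p [/dist_lift[y ->] /IHs[t ->] _]]].
by exists (y :: t).
Qed.

Lemma valid_incl k l s : valid k l (map f s) = valid k l s.
Proof.
rewrite /valid size_map len_incl sorted_map; congr [&& _, _ & _].
by apply: eq_sorted => x y; rewrite /= (inj_eq f_inj).
Qed.

Lemma MCmap_incl_bas k l s : MCmap f (bas k l s) = bas k l (map f s).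
Proof.
rewrite MCmap_bas; case: ifPn => // sN.
by rewrite bas_invalid // valid_incl.
Qed.

Definition fiber_pt (u : G') : option G := [pick x | f x == u].

Lemma fiber_ptK : pcancel f fiber_pt.
Proof.
move=> x; rewrite /fiber_pt; case: pickP => [y /eqP/f_inj->//|/(_ x)].
by rewrite eqxx.
Qed.

Lemma fiber_pt_out u : (forall x, f x != u) -> fiber_pt u = None.
Proof.
by move=> uN; rewrite /fiber_pt; case: pickP => // x; rewrite (negPf (uN x)).
Qed.

(** [pmap] drops the entries outside the image of [f], so a tuple with such an
    entry becomes too short to be a generator and [bas] sends it to 0. *)
Definition MCpull (k l : nat) : MC G' k l -> MC G k l :=
  lin (fun x : gen G' k l => bas k l (pmap fiber_pt (tval (val x)))).

HB.instance Definition _ k l :=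
  GRing.isZmodMorphism.Build (MC G' k l) (MC G k l) (@MCpull k l)
    (lin_is_zmod_morphism _).

Lemma MCpull_bas k l s : MCpull (bas k l s) =
  if valid k l s then bas k l (pmap fiber_pt s) else 0.
Proof. exact: (@lin_bas G' k l _ (fun t => bas k l (pmap fiber_pt t)) s). Qed.

Lemma MCpull_bas_incl k l s : MCpull (bas k l (map f s)) = bas k l s.
Proof.
rewrite MCpull_bas valid_incl (map_pK fiber_ptK).
by case: ifPn => // sN; rewrite bas_invalid.
Qed.

Lemma MCpull_bas_out k l u s :
  (forall x, f x != u) -> MCpull (bas k l (u :: s)) = 0.
Proof.
move=> uN; rewrite MCpull_bas; case: ifP => // /andP[/eqP[<-] _].
rewrite bas_invalid //= fiber_pt_out //=.
apply/negP=> /andP[]; rewrite size_pmap => /eqP sE.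
by have := count_size fiber_pt s; rewrite sE ltnn.
Qed.

Lemma MCmapK k l : cancel (@MCmap G G' f k l) (@MCpull k l).
Proof.
apply: (@MC_additive_ext _ _ _ _
  (@MCpull k l \o @MCmap G G' f k l) idfun) => s _ /=.
by rewrite MCmap_incl_bas MCpull_bas_incl.
Qed.

(** On a generator in the image of [f] this follows from [MCmapK], because
    [MCmap f] is a chain map.  A generator whose first entry is outside the image
    is killed, and so are its faces, since they have the same first entry. *)
Lemma MCpull_d k l (c : MC G' k l) : d (MCpull c) = MCpull (d c).
Proof.
apply: (@MC_additive_ext _ _ _ _
  (@d G k l \o @MCpull k l) (@MCpull k.-1 l \o @d G' k l)) => s sv /=.
case: s sv => // u s sv.
case: (pickP (fun x => f x == u)) => [x /eqP uE|uN].
  have /and3P[_ _ /eqP] := sv; rewrite -uE => /len_lift[t ->].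
  by rewrite -map_cons -MCmap_incl_bas MCmapK MCmap_d MCmapK.
have {}uN x : f x != u by rewrite uN.
rewrite MCpull_bas_out // raddf0 d_bas sv raddf_sum big_nat big1 // => -[//|i _].
by rewrite raddfMz omitS /= MCpull_bas_out ?mul0rz.
Qed.

Variables k l : nat.

Lemma MCpull_cycle (z : cycle_group G' k l) : is_cycle (MCpull (val z)).
Proof. by apply/eqP; rewrite MCpull_d (eqP (valP z)) raddf0. Qed.

Definition cycle_pull (z : cycle_group G' k l) : cycle_group G k l :=
  Sub (MCpull (val z)) (MCpull_cycle z).

Definition MHpull (a : MH G' k l) : MH G k l := hclass (cycle_pull (repr a)).

Lemma MHpull_hclass z : MHpull (hclass z) = hclass (cycle_pull z).
Proof.
have /hclass_eq[b bE] : hclass (repr (hclass z)) = hclass z by apply: reprK.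
by apply/hclass_eq; exists (MCpull b); rewrite MCpull_d bE !raddfB.
Qed.

End ComponentInclusion.

Lemma MCpull_disjoint (G H K : graph) (f : graph_map G K) (g : graph_map H K)
    (k l : nat) (c : MC H k l) :
    injective g -> edge_lifting g -> (forall x y, f x != g y) ->
  MCpull f (MCmap g c) = 0.
Proof.
move=> g_inj g_lift fg; apply: (@MC_additive_ext _ _ _ _
  (@MCpull _ _ f k l \o @MCmap _ _ g k l) \0) => s sv /=.
rewrite MCmap_incl_bas //; case: s sv => // y s _.
by rewrite MCpull_bas_out.
Qed.

Section HomologyClasses.
Variables (G : graph) (k l : nat).

Lemma hclassB : {morph @hclass G k l : z z' / z - z'}.
Proof. by move=> z z'; rewrite /hclass raddfB. Qed.

Lemma hclassD : {morph @hclass G k l : z z' / z + z'}.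
Proof. by move=> z z'; rewrite /hclass raddfD. Qed.

Lemma hclassP (a : MH G k l) : exists z, hclass z = a.
Proof. by exists (repr a); apply: reprK. Qed.

End HomologyClasses.

Lemma MHmapB (G G' : graph) (f : graph_map G G') (k l : nat) :
  {morph @MHmap G G' f k l : a b / a - b}.
Proof.
move=> a b; have [[z <-] [w <-]] := (hclassP a, hclassP b).
by rewrite -hclassB !MHmap_hclass raddfB hclassB.
Qed.

Section Decomposition.
Variables (G H K : graph) (f : graph_map G K) (g : graph_map H K).
Hypotheses (f_inj : injective f) (f_lift : edge_lifting f).
Hypotheses (g_inj : injective g) (g_lift : edge_lifting g).
Hypothesis fg_disjoint : forall x y, f x != g y.
Hypothesis fg_cover : forall u, (exists x, f x = u) \/ (exists y, g y = u).
Variables k l : nat.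

Let gf_disjoint y x : g y != f x. Proof. by rewrite eq_sym. Qed.

Lemma valid_split (s : seq K) : valid k l s ->
  (exists t, s = map f t) \/ (exists t, s = map g t).
Proof.
case: s => // u s /and3P[_ _ /eqP]; have [[x <-]|[y <-]] := fg_cover u.
  by case/(len_lift f_lift)=> t ->; left; exists (x :: t).
by case/(len_lift g_lift)=> t ->; right; exists (y :: t).
Qed.

(** By [valid_split] each generator comes from exactly one side, where one
    projector fixes it and the other kills it. *)
Lemma MC_split (c : MC K k l) :
  MCmap f (MCpull f c) + MCmap g (MCpull g c) = c.
Proof.
apply: (@MC_additive_ext _ _ _ _
  ((@MCmap _ _ f k l \o @MCpull _ _ f k l) \+
   (@MCmap _ _ g k l \o @MCpull _ _ g k l)) idfun) => s /= /valid_split.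
case=> -[t ->].
  by rewrite -(MCmap_incl_bas f_inj) // MCmapK // MCpull_disjoint // raddf0 addr0.
by rewrite -(MCmap_incl_bas g_inj) // MCmapK // MCpull_disjoint // raddf0 add0r.
Qed.

Lemma MHsum_bij : bijective (fun ab : (MH G k l * MH H k l)%type =>
  MHmap f ab.1 + MHmap g ab.2).
Proof.
exists (fun a => (MHpull f_inj f_lift a, MHpull g_inj g_lift a)) => [[a b]|c].
  have [[z <-] [w <-]] := (hclassP a, hclassP b).
  rewrite !MHmap_hclass -hclassD !MHpull_hclass.
  congr (hclass _, hclass _); apply: val_inj; rewrite /= !raddfD /= MCmapK //.
    by rewrite MCpull_disjoint ?addr0.
  by rewrite MCpull_disjoint ?add0r.
have [z <-] := hclassP c; rewrite !MHpull_hclass !MHmap_hclass -hclassD.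
by congr hclass; apply: val_inj; rewrite /= MC_split.
Qed.

End Decomposition.

Theorem proposition17 (G H : graph) (k l : nat) :
  let phi := fun ab : (MH G k l * MH H k l)%type =>
    MHmap (incl_l G H) ab.1 + MHmap (incl_r G H) ab.2
      : MH (disjoint_union G H) k l in
  zmod_morphism phi /\ bijective phi.
Proof.
move=> phi; split=> [[a b] [a' b']|].
  by rewrite /phi /= !MHmapB opprD addrACA.
apply: MHsum_bij.
- by move=> x y [].
- by move=> x [y|y] // xy; exists y.
- by move=> x y [].
- by move=> x [y|y] // xy; exists y.
- by [].
by move=> [x|y]; [left; exists x | right; exists y].
Qed.
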